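(* Let $0<\theta<2\pi$, let $\alpha,\beta\in\mathbb{C}$ with $|\alpha|\neq 1$, and let $$m_{\alpha,\beta,\theta}(z)=\frac{z^\beta}{z-\alpha}=\frac{e^{\beta\log_\theta(z)}}{z-\alpha}.$$ If $|\alpha|>1$, then $$\int_{\partial\mathbb{D}} m_{\alpha,\beta,\theta}=\begin{cases}-2\pi i\,\alpha^{\beta} & \text{if }\beta\in\mathbb{Z}_{<0},\\ 0 & \text{if }\beta=0,\\ e^{i\beta\theta}\left(1-e^{-2\pi i\beta}\right)\frac{1}{\beta}\left[1-{}_2F_1(1,\beta;1+\beta;\alpha^{-1}e^{i\theta})\right] & \text{if }\beta\in\mathbb{C}\setminus\mathbb{Z}_{\le 0}.\end{cases}$$ If $|\alpha|<1$, then $$\int_{\partial\mathbb{D}} m_{\alpha,\beta,\theta}=\begin{cases}2\pi i\,\alpha^{\beta} & \text{if }\beta\in\mathbb{Z}_{\ge 0},\\ e^{i\beta\theta}\left(1-e^{-2\pi i\beta}\right)\frac{1}{\beta}\,{}_2F_1(1,-\beta;1-\beta;\alpha e^{-i\theta}) & \text{if }\beta\in\mathbb{C}\setminus\mathbb{Z}_{\ge 0}.\end{cases}$$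
   Context: For $0<\theta<2\pi$, $\log_\theta$ is the branch of the complex logarithm on $\mathbb{C}\setminus\{re^{i\theta}:r\ge 0\}$ with $\log_\theta(1)=0$, that is, $\log_\theta(z)=\ln|z|+i\arg_\theta(z)$ with $\arg_\theta(z)\in(\theta-2\pi,\theta)$. $\partial\mathbb{D}=\{z:|z|=1\}$ is the unit circle traversed counterclockwise. The integrand is undefined at the single point $e^{i\theta}$, where it has a jump, and the integral means $$\int_{\partial\mathbb{D}}m_{\alpha,\beta,\theta}=\int_{\theta-2\pi}^{\theta}\frac{e^{i\beta t}}{e^{it}-\alpha}\,ie^{it}\,dt .$$ The powers $\alpha^\beta$ in the statement occur only for integer $\beta$ and are ordinary integer powers, with $0^0=1$. For $|z|<1$ and $c\in\mathbb{C}\setminus\mathbb{Z}_{\le 0}$, the hypergeometric function is ${}_2F_1(a,b;c;z)=\sum_{n=0}^\infty\frac{(a)_n(b)_n}{(c)_n\,n!}z^n$, where $(x)_n=x(x+1)\cdots(x+n-1)$, $(x)_0=1$ (the rising Pochhammer symbol, $\Gamma(x+n)/\Gamma(x)$). *)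

(* Defs.v *)
(* Stdlib reals and Coquelicot's complex numbers [C]. *)
From Stdlib Require Import Reals Lra ZArith.
From Coquelicot Require Import Coquelicot.
Open Scope R_scope.

Definition Cexp (z : C) : C :=
  (exp (Re z) * cos (Im z), exp (Re z) * sin (Im z)).

(* Complex analogue of [powerRZ]; in particular [Cpowz 0 0 = 1]. *)
Definition Cpowz (z : C) (k : Z) : C :=
  match k with
  | Z0 => 1
  | Zpos p => Cpow z (Pos.to_nat p)
  | Zneg p => Cinv (Cpow z (Pos.to_nat p))
  end.

(* Meaningful off the ray from 0 through [e^(i theta)], where exactly one [t]
   qualifies (see [Carg_eq]). *)
Definition Carg (theta : R) (z : C) : R :=
  iota (fun t : R => theta - 2 * PI < t < theta
                     /\ z = Cmult (Cmod z) (Cexp (Cmult Ci t))).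

Definition Clog (theta : R) (z : C) : C :=
  Cplus (ln (Cmod z)) (Cmult Ci (Carg theta z)).

Definition m (alpha beta : C) (theta : R) (z : C) : C :=
  Cdiv (Cexp (Cmult beta (Clog theta z))) (Cminus z alpha).

(* The contour integral of [f] over the counterclockwise unit circle exists and
   equals [l]; the circle is run through from [e^(i theta)] back to itself.  A
   Riemann integral does not depend on the values of the integrand at the
   endpoints, so it is harmless that [Clog theta] is junk at [e^(i theta)];
   [is_circle_int_m] gives the resulting closed form. *)
Definition is_circle_int (theta : R) (f : C -> C) (l : C) : Prop :=
  is_RInt (V := C_R_NormedModule)
    (fun t : R => let z := Cexp (Cmult Ci t) in Cmult (f z) (Cmult Ci z))
    (theta - 2 * PI) theta l.

Fixpoint Cpoch (x : C) (n : nat) : C :=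
  match n with
  | O => 1
  | S n' => Cmult (Cpoch x n') (Cplus x (INR n'))
  end.

Definition hyp2F1_term (a b c z : C) (n : nat) : C :=
  Cmult (Cdiv (Cmult (Cpoch a n) (Cpoch b n))
              (Cmult (Cpoch c n) (INR (fact n))))
        (Cpow z n).

(* The sum of the series where it converges (see [hyp2F1_unique]), in particular
   for [Cmod z < 1] and [c] not a nonpositive integer. *)
Definition hyp2F1 (a b c z : C) : C :=
  iota (T := C_CompleteNormedModule)
    (fun l => is_series (V := C_NormedModule) (hyp2F1_term a b c z) l).

Lemma hyp2F1_unique (a b c z l : C) :
  is_series (V := C_NormedModule) (hyp2F1_term a b c z) l ->
  hyp2F1 a b c z = l.
Proof.
intros Hl; unfold hyp2F1.
apply (iota_unique (V := C_CompleteNormedModule)); [|exact Hl].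
intros y Hy.
exact (filterlim_locally_unique (V := C_NormedModule) _ _ _ Hy Hl).
Qed.

Lemma Cexp_Ci (t : R) : Cexp (Cmult Ci t) = (cos t, sin t).
Proof.
unfold Cexp; simpl.
replace (0 * t - 1 * 0) with 0 by ring.
replace (0 * 0 + 1 * t) with t by ring.
now rewrite exp_0, !Rmult_1_l.
Qed.

Lemma Cmod_Cexp_Ci (t : R) : Cmod (Cexp (Cmult Ci t)) = 1.
Proof.
rewrite Cexp_Ci; unfold Cmod; simpl.
replace (_ + _) with 1; [exact sqrt_1|].
generalize (sin2_cos2 t); unfold Rsqr; lra.
Qed.

Lemma cos_sin_inj (s t : R) :
  cos s = cos t -> sin s = sin t -> -2 * PI < s - t < 2 * PI -> s = t.
Proof.
intros Hc Hs Hst.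
assert (H1 : cos (2 * ((s - t) / 2)) = 1).
{ replace (2 * ((s - t) / 2)) with (s - t) by field.
  rewrite cos_minus, Hc, Hs.
  generalize (sin2_cos2 t); unfold Rsqr; lra. }
rewrite cos_2a_sin in H1.
assert (H0 : sin ((s - t) / 2) = 0) by nra.
destruct (Rtotal_order s t) as [H | [H | H]]; [|exact H|].
- assert (H2 : 0 < sin (- ((s - t) / 2))) by (apply sin_gt_0; lra).
  rewrite sin_neg in H2; lra.
- assert (H2 : 0 < sin ((s - t) / 2)) by (apply sin_gt_0; lra).
  lra.
Qed.

Lemma Carg_eq (theta r t : R) :
  0 < r -> theta - 2 * PI < t < theta ->
  Carg theta (Cmult r (Cexp (Cmult Ci t))) = t.
Proof.
intros Hr Ht; unfold Carg.
assert (Hm : Cmod (Cmult r (Cexp (Cmult Ci t))) = r).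
{ rewrite Cmod_mult, Cmod_Cexp_Ci, Cmod_R, Rabs_pos_eq; lra. }
apply (iota_unique (V := R_CompleteNormedModule)); rewrite Hm;
  [|now split].
intros y [Hy E].
rewrite !Cexp_Ci in E.
injection E; intros E2 E1.
symmetry; apply cos_sin_inj; [nra|nra|lra].
Qed.

Lemma m_circle (alpha beta : C) (theta t : R) :
  theta - 2 * PI < t < theta ->
  m alpha beta theta (Cexp (Cmult Ci t))
  = Cdiv (Cexp (Cmult (Cmult Ci beta) t)) (Cminus (Cexp (Cmult Ci t)) alpha).
Proof.
intros Ht; unfold m, Clog.
rewrite Cmod_Cexp_Ci, ln_1.
replace (Carg theta (Cexp (Cmult Ci t))) with t.
- do 2 f_equal; ring.
- rewrite <- (Carg_eq theta 1 t) at 1; [|lra|exact Ht].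
  f_equal; ring.
Qed.

Lemma is_circle_int_m (alpha beta : C) (theta : R) (l : C) :
  is_circle_int theta (m alpha beta theta) l <->
  is_RInt (V := C_R_NormedModule)
    (fun t : R =>
       Cmult (Cdiv (Cexp (Cmult (Cmult Ci beta) t))
                   (Cminus (Cexp (Cmult Ci t)) alpha))
             (Cmult Ci (Cexp (Cmult Ci t))))
    (theta - 2 * PI) theta l.
Proof.
assert (HPI := PI_RGT_0).
unfold is_circle_int; split; apply is_RInt_ext; intros t;
  rewrite Rmin_left, Rmax_right by lra; intros Ht; cbv zeta;
  now rewrite m_circle.
Qed.

(* Main.v *)
Require Import Defs.
From Stdlib Require Import Reals ZArith Lra Lia.
From Coquelicot Require Import Coquelicot.
Open Scope R_scope.

(** Put [z = e^(it)].  The factor [i e^(it) / (e^(it) - alpha)] is governed by a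
    geometric series whose ratio has constant modulus less than [1]:

    - for [|alpha| < 1] it is [i / (1 - alpha e^(-it))];
    - for [|alpha| > 1] it is [i (1 - 1 / (1 - e^(it) / alpha))].

    In both cases one needs the integral over a full turn of the kernel
    [e^(i beta t) / (1 - c e^(ist))] with [|c| < 1] and [s = -1] or [s = 1].
    In the second it is subtracted from the integral of [e^(i beta t)], which is
    the term of index [0] of the series below; hence the [1 - 2F1] there, and
    the value [0] for [beta = 0].
    The geometric series converges uniformly, so it may be integrated term by
    term ([is_RInt_geometric]), which gives the sum of [c^n E n], where [E n] is
    the integral over a full turn of [e^(igt)] with [g = beta + s n].

    If [beta = -s n0] for a natural number [n0], all frequencies [g] are
    integers, only [n = n0] survives, and the kernel integrates to
    [2 pi c^n0] ([is_RInt_kernel_resonant]).  Otherwise no frequency vanishes,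
    [E n] is [e^(ig theta) (1 - e^(-2 pi i g)) / (ig)], and as [s n] is an
    integer, [e^(-2 pi i g)] does not depend on [n]: up to a constant factor the
    [n]-th term is [(c e^(is theta))^n / (beta + s n)].  Since
    [(1)_n (b)_n / ((1 + b)_n n!) = b / (b + n)], that is the series
    of [2F1(1, s beta; 1 + s beta; c e^(is theta))]
    ([is_RInt_kernel_hyp2F1]). *)

(** * The complex exponential *)

Lemma Cexp_plus (z w : C) : Cexp (z + w) = (Cexp z * Cexp w)%C.
Proof.
destruct z as [x y], w as [u v]; unfold Cexp, Cmult, Cplus; simpl.
rewrite exp_plus, cos_plus, sin_plus.
f_equal; ring.
Qed.

Lemma Cexp_0 : Cexp 0 = 1.
Proof.
unfold Cexp; simpl; rewrite exp_0, cos_0, sin_0.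
unfold RtoC; f_equal; ring.
Qed.

Lemma Cmod_Cexp (z : C) : Cmod (Cexp z) = exp (Re z).
Proof.
replace (Cexp z) with (RtoC (exp (Re z)) * Cexp (Ci * RtoC (Im z)))%C.
- rewrite Cmod_mult, Cmod_Cexp_Ci, Cmod_R, Rabs_pos_eq; [ring|].
  apply Rlt_le, exp_pos.
- rewrite Cexp_Ci; unfold Cexp, Cmult, RtoC; simpl; f_equal; ring.
Qed.

Lemma Cexp_neq_0 (z : C) : Cexp z <> 0.
Proof. apply Cmod_gt_0; rewrite Cmod_Cexp; apply exp_pos. Qed.

Lemma Cexp_opp (z : C) : Cexp (- z) = (/ Cexp z)%C.
Proof.
assert (H : (Cexp z * Cexp (- z))%C = 1).
{ rewrite <- Cexp_plus, <- Cexp_0; f_equal; ring. }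
rewrite <- (Cmult_1_r (/ Cexp z)), <- H; field; apply Cexp_neq_0.
Qed.

Lemma Cexp_INR_mult (n : nat) (z : C) : Cexp (INR n * z) = (Cexp z ^ n)%C.
Proof.
induction n as [|n IH].
- simpl; replace (0 * z)%C with (RtoC 0) by ring; exact Cexp_0.
- rewrite S_INR, Cpow_S, <- IH, <- Cexp_plus, RtoC_plus; f_equal; ring.
Qed.

Lemma Cexp_period (k : Z) : Cexp (2 * PI * Ci * IZR k) = 1.
Proof.
assert (H : forall n : nat, Cexp (2 * PI * Ci * INR n) = 1).
{ intros n.
  replace (2 * PI * Ci * INR n)%C with (INR n * (Ci * RtoC (2 * PI)))%C
    by (rewrite RtoC_mult; ring).
  rewrite Cexp_INR_mult, Cexp_Ci, cos_2PI, sin_2PI.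
  apply Cpow_1_l. }
destruct (Z_le_gt_dec 0 k) as [Hk | Hk].
- rewrite <- (Z2Nat.id k Hk), <- INR_IZR_INZ; apply H.
- specialize (H (Z.to_nat (- k))).
  rewrite INR_IZR_INZ, Z2Nat.id, opp_IZR, RtoC_opp in H by lia.
  rewrite <- (Cmult_1_r (Cexp _)), <- H at 1.
  rewrite <- Cexp_plus, <- Cexp_0; f_equal; ring.
Qed.

(** * Complex-valued integrals and series *)

(** Completeness does not mention the scalars, so the proof for [C] over [C]
    serves for [C] over [R], the structure over which curves in [C] are
    integrated. *)
Definition C_R_CompleteNormedModule : CompleteNormedModule R_AbsRing :=
  CompleteNormedModule.Pack R_AbsRing C
    (CompleteNormedModule.Class R_AbsRing C
       (NormedModule.class R_AbsRing C_R_NormedModule) C_CompleteSpace_mixin) C.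

(** The equality to prove is stated in [C], where [ring] and [field] apply, and
    not in the carrier of a normed module. *)
Lemma is_RInt_C_ext (f g : R -> C) (a b : R) (l : C) :
  (forall t : R, Rmin a b < t < Rmax a b -> f t = g t) ->
  is_RInt (V := C_R_NormedModule) f a b l ->
  is_RInt (V := C_R_NormedModule) g a b l.
Proof. exact (is_RInt_ext (V := C_R_NormedModule) f g a b l). Qed.

(** The scalars of [is_RInt_scal] are real here, so complex homogeneity is
    reduced to the real and imaginary parts. *)
Lemma is_RInt_Cmult (c : C) (f : R -> C) (a b : R) (l : C) :
  is_RInt (V := C_R_NormedModule) f a b l ->
  is_RInt (V := C_R_NormedModule) (fun t => (c * f t)%C) a b (c * l)%C.
Proof.
intros H.
assert (H1 := is_RInt_fct_extend_fst
  (U := R_NormedModule) (V := R_NormedModule) _ _ _ _ H).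
assert (H2 := is_RInt_fct_extend_snd
  (U := R_NormedModule) (V := R_NormedModule) _ _ _ _ H).
apply (is_RInt_fct_extend_pair (U := R_NormedModule) (V := R_NormedModule));
  simpl.
- exact (is_RInt_minus _ _ _ _ _ _
    (is_RInt_scal _ _ _ (fst c) _ H1) (is_RInt_scal _ _ _ (snd c) _ H2)).
- exact (is_RInt_plus _ _ _ _ _ _
    (is_RInt_scal _ _ _ (fst c) _ H2) (is_RInt_scal _ _ _ (snd c) _ H1)).
Qed.

Lemma is_series_C_ext (u v : nat -> C) (l : C) :
  (forall n, u n = v n) ->
  is_series (V := C_NormedModule) u l -> is_series (V := C_NormedModule) v l.
Proof. exact (is_series_ext (V := C_NormedModule) u v l). Qed.

Lemma is_series_single (u : nat -> C) (n0 : nat) (l : C) :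
  (forall n, n <> n0 -> u n = 0) ->
  is_series (V := C_NormedModule) u l -> l = u n0.
Proof.
intros Hu Hl.
assert (H : forall N, (sum_n (G := C_AbelianGroup) u N : C)
                      = if le_dec n0 N then u n0 else 0).
{ induction N as [|N IH].
  - rewrite sum_O; destruct (le_dec n0 0); [f_equal; lia|apply Hu; lia].
  - rewrite sum_Sn, IH; unfold plus; simpl.
    destruct (le_dec n0 N), (le_dec n0 (S N)); try lia.
    + rewrite (Hu (S N)) by lia; ring.
    + replace (S N) with n0 by lia; ring.
    + rewrite (Hu (S N)) by lia; ring. }
refine (filterlim_locally_unique (V := C_NormedModule) _ _ _ Hl _).
refine (filterlim_ext_loc (fun _ => u n0) _ _ (filterlim_const (u n0))).
exists n0; intros N HN; rewrite H; now destruct (le_dec n0 N).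
Qed.

(** * Full-turn integrals of exponentials *)

Lemma is_RInt_Cexp (g : C) (a b : R) :
  g <> 0 ->
  is_RInt (V := C_R_NormedModule) (fun t : R => Cexp (Ci * g * t)) a b
    ((Cexp (Ci * g * b) - Cexp (Ci * g * a)) / (Ci * g))%C.
Proof.
intros Hg.
assert (Hi : Ci <> 0) by (intros E; injection E; lra).
assert (H : is_RInt (V := C_R_NormedModule)
  (fun t : R => Ci * g * Cexp (Ci * g * t))%C a b
  (Cexp (Ci * g * b) - Cexp (Ci * g * a))%C).
{ destruct g as [u v].
  apply (is_RInt_fct_extend_pair (U := R_NormedModule) (V := R_NormedModule));
    simpl.
  - apply (is_RInt_derive (V := R_CompleteNormedModule)
      (fun t => fst (Cexp (Ci * (u, v) * t)))).
    + intros x _; unfold Cexp; simpl; auto_derive;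
        [trivial|unfold Rminus; ring].
    + intros x _; unfold Cexp; simpl.
      apply (ex_derive_continuous (V := R_NormedModule)); auto_derive; trivial.
  - apply (is_RInt_derive (V := R_CompleteNormedModule)
      (fun t => snd (Cexp (Ci * (u, v) * t)))).
    + intros x _; unfold Cexp; simpl; auto_derive;
        [trivial|unfold Rminus; ring].
    + intros x _; unfold Cexp; simpl.
      apply (ex_derive_continuous (V := R_NormedModule)); auto_derive;
        trivial. }
apply (is_RInt_Cmult (/ (Ci * g))) in H.
replace ((Cexp (Ci * g * b) - Cexp (Ci * g * a)) / (Ci * g))%C
  with (/ (Ci * g) * (Cexp (Ci * g * b) - Cexp (Ci * g * a)))%C
  by (field; auto).
revert H; apply is_RInt_C_ext; intros t _; field; auto.
Qed.

(** Both ends of the turn are expressed through the upper one: this is the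
    factor [1 - e^(-2 pi i g)] of the closed forms. *)
Lemma is_RInt_Cexp_turn (theta : R) (g : C) :
  g <> 0 ->
  is_RInt (V := C_R_NormedModule) (fun t : R => Cexp (Ci * g * t))
    (theta - 2 * PI) theta
    (Cexp (Ci * g * theta) * (1 - Cexp (- (2 * PI * Ci * g))) / (Ci * g))%C.
Proof.
intros Hg.
assert (H := is_RInt_Cexp g (theta - 2 * PI) theta Hg).
replace (Ci * g * RtoC (theta - 2 * PI))%C
  with (Ci * g * theta + - (2 * PI * Ci * g))%C in H
  by (rewrite RtoC_minus, RtoC_mult; ring).
rewrite Cexp_plus in H.
replace (Cexp (Ci * g * theta) * (1 - Cexp (- (2 * PI * Ci * g))))%C
  with (Cexp (Ci * g * theta)
        - Cexp (Ci * g * theta) * Cexp (- (2 * PI * Ci * g)))%C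
  by ring.
exact H.
Qed.

Lemma is_RInt_Cexp_turn_0 (theta : R) (g : C) :
  g = 0 ->
  is_RInt (V := C_R_NormedModule) (fun t : R => Cexp (Ci * g * t))
    (theta - 2 * PI) theta (2 * PI)%C.
Proof.
intros ->.
replace (2 * PI)%C
  with (scal (V := C_R_NormedModule) (theta - (theta - 2 * PI)) (RtoC 1)).
- apply (is_RInt_C_ext (fun _ => RtoC 1));
    [|apply (is_RInt_const (V := C_R_NormedModule))].
  intros t _; rewrite <- Cexp_0; f_equal; ring.
- unfold scal; simpl; unfold prod_scal, scal, mult, Cmult, RtoC; simpl.
  unfold mult; simpl; f_equal; ring.
Qed.

(** Orthogonality of the characters of the circle. *)
Lemma is_RInt_Cexp_turn_Z (theta : R) (k : Z) :
  k <> 0%Z ->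
  is_RInt (V := C_R_NormedModule) (fun t : R => Cexp (Ci * IZR k * t))
    (theta - 2 * PI) theta (RtoC 0).
Proof.
intros Hk.
assert (Hk' : RtoC (IZR k) <> 0).
{ intros E; apply RtoC_inj, eq_IZR in E; auto. }
assert (H := is_RInt_Cexp_turn theta _ Hk').
replace (- (2 * PI * Ci * IZR k))%C with (2 * PI * Ci * IZR (- k))%C in H
  by (rewrite opp_IZR, RtoC_opp; ring).
rewrite Cexp_period in H.
replace (RtoC 0) with
  (Cexp (Ci * IZR k * theta) * (1 - 1) / (Ci * IZR k))%C; [exact H|].
unfold Cdiv; ring.
Qed.

(** * Integrating a geometric series term by term *)

Lemma is_RInt_sum_n (f : nat -> R -> C) (a b : R) (l : nat -> C) (N : nat) :
  (forall n, is_RInt (V := C_R_NormedModule) (f n) a b (l n)) ->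
  is_RInt (V := C_R_NormedModule)
    (fun t => sum_n (G := C_AbelianGroup) (fun n => f n t) N) a b
    (sum_n (G := C_AbelianGroup) l N).
Proof.
intros H; induction N as [|N IH].
- rewrite sum_O.
  apply (is_RInt_C_ext (f 0%nat)); [|apply H].
  intros t _; now rewrite sum_O.
- rewrite sum_Sn.
  refine (is_RInt_C_ext _ _ _ _ _ _ (is_RInt_plus _ _ _ _ _ _ IH (H (S N)))).
  intros t _; now rewrite sum_Sn.
Qed.

Lemma sum_n_geometric (f q : C) (N : nat) :
  q <> 1 ->
  sum_n (G := C_AbelianGroup) (fun n => f * q ^ n)%C N
  = (f / (1 - q) - f * q ^ S N / (1 - q))%C.
Proof.
intros Hq.
assert (Hq' : (1 - q)%C <> 0).
{ intros E; apply Hq; replace q with (1 - (1 - q))%C by ring; rewrite E; ring. }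
induction N as [|N IH].
- rewrite sum_O; simpl; field; auto.
- rewrite sum_Sn, IH; unfold plus; simpl; field; auto.
Qed.

(** The remainder after the power [N] is [f q^(N+1) / (1 - q)], which is at most
    [M r^(N+1) / (1 - r)] in modulus on the whole interval: convergence is
    uniform, so integration and summation commute.  The series of integrals
    converges as part of the conclusion, which later spares a separate
    convergence proof for the hypergeometric series. *)
Lemma is_RInt_geometric (f q : R -> C) (a b M r : R) (E : nat -> C) :
  a <= b -> r < 1 ->
  (forall t, a <= t <= b -> Cmod (f t) <= M) ->
  (forall t, a <= t <= b -> Cmod (q t) <= r) ->
  (forall n : nat,
     is_RInt (V := C_R_NormedModule) (fun t => f t * q t ^ n)%C a b (E n)) ->
  exists l : C, is_series (V := C_NormedModule) E l
    /\ is_RInt (V := C_R_NormedModule) (fun t => f t / (1 - q t))%C a b l.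
Proof.
intros Hab Hr Hf Hq HE.
(* [filterlim_RInt] asks for uniform convergence on all of [R], whereas the
   bounds hold on [[a, b]] only; precomposing with the projection of [R] onto
   [[a, b]] extends them without changing any integral. *)
set (cl t := Rmax a (Rmin b t)).
assert (Hcl : forall t, a <= cl t <= b).
{ intros t; unfold cl; split; [apply Rmax_l|].
  apply Rmax_lub; [exact Hab|apply Rmin_l]. }
assert (Hid : forall t, Rmin a b < t < Rmax a b -> cl t = t).
{ intros t; rewrite Rmin_left, Rmax_right by lra; intros Ht; unfold cl.
  rewrite Rmin_right, Rmax_right; lra. }
assert (HM : 0 <= M).
{ apply Rle_trans with (Cmod (f a)); [apply Cmod_ge_0|apply Hf; lra]. }
assert (Hr0 : 0 <= r).
{ apply Rle_trans with (Cmod (q a)); [apply Cmod_ge_0|apply Hq; lra]. }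
destruct (filterlim_RInt (V := C_R_CompleteNormedModule)
  (fun N t =>
     sum_n (G := C_AbelianGroup) (fun n => f (cl t) * q (cl t) ^ n)%C N)
  a b eventually eventually_filter
  (fun t => f (cl t) / (1 - q (cl t)))%C
  (fun N => sum_n (G := C_AbelianGroup) E N)) as [l [Hl HI]].
- intros N.
  apply (is_RInt_sum_n (fun n t => f (cl t) * q (cl t) ^ n)%C).
  intros n; refine (is_RInt_C_ext _ _ _ _ _ _ (HE n)).
  intros t Ht; simpl; now rewrite Hid.
- apply filterlim_locally; intros eps.
  (* [M + 1] stands in for [M], which may be zero. *)
  destruct (pow_lt_1_zero r) with (y := eps * (1 - r) / (M + 1)) as [N HN].
  { rewrite Rabs_pos_eq; lra. }
  { apply Rdiv_lt_0_compat; [|lra].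
    apply Rmult_lt_0_compat; [apply cond_pos|lra]. }
  exists N; intros n Hn t.
  apply C_NormedModule_mixin_compat1.
  set (u := cl t); specialize (Hf u (Hcl t)); specialize (Hq u (Hcl t)).
  assert (H1 : 1 - r <= Cmod (1 - q u)).
  { assert (H := Cmod_triangle (1 - q u) (q u)).
    replace (1 - q u + q u)%C with (RtoC 1) in H by ring.
    rewrite Cmod_1 in H; lra. }
  assert (Hne : (1 - q u)%C <> 0).
  { apply Cmod_gt_0; lra. }
  rewrite sum_n_geometric.
  2: { intros Eq; rewrite Eq, Cmod_1 in Hq; lra. }
  unfold minus, plus, opp; simpl.
  replace (_ + _)%C with (- (f u * q u ^ S n / (1 - q u)))%C
    by (simpl; field; exact Hne).
  rewrite Cmod_opp, Cmod_div, Cmod_mult, Cmod_pow by exact Hne.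
  specialize (HN (S n) ltac:(lia)).
  rewrite Rabs_pos_eq in HN by (apply pow_le; lra).
  assert (H2 : Cmod (q u) ^ S n <= r ^ S n).
  { apply pow_incr; split; [apply Cmod_ge_0|exact Hq]. }
  apply Rlt_div_l; [lra|].
  apply Rle_lt_trans with (M * r ^ S n).
  { apply Rmult_le_compat; auto using Cmod_ge_0, pow_le. }
  apply Rlt_le_trans with (eps * (1 - r)).
  2: { apply Rmult_le_compat_l; [apply Rlt_le, cond_pos|exact H1]. }
  apply Rlt_div_r in HN; [|lra].
  assert (0 <= r ^ S n) by (apply pow_le; lra).
  nra.
- exists l; split; [exact Hl|].
  refine (is_RInt_C_ext _ _ _ _ _ _ HI).
  intros t Ht; now rewrite Hid.
Qed.

(** * The Cauchy-type kernel *)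

(** The factor [e^(i beta t)] has modulus [e^(- Im beta t)], which is bounded on
    a turn, and the ratio [c e^(ist)] has the constant modulus [|c|]. *)
Lemma is_RInt_kernel (theta : R) (beta c : C) (s : R) (E : nat -> C) :
  Cmod c < 1 ->
  (forall n : nat, is_RInt (V := C_R_NormedModule)
     (fun t : R => Cexp (Ci * (beta + s * INR n) * t))
     (theta - 2 * PI) theta (E n)) ->
  exists l : C, is_series (V := C_NormedModule) (fun n => c ^ n * E n)%C l
    /\ is_RInt (V := C_R_NormedModule)
         (fun t : R => Cexp (Ci * beta * t) / (1 - c * Cexp (Ci * s * t)))%C
         (theta - 2 * PI) theta l.
Proof.
intros Hc HE.
apply (is_RInt_geometric (fun t => Cexp (Ci * beta * t))
  (fun t => c * Cexp (Ci * s * t))%C _ _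
  (exp (Rabs (Im beta) * (Rabs theta + 2 * PI))) (Cmod c)).
- assert (H := PI_RGT_0); lra.
- exact Hc.
- intros t Ht; rewrite Cmod_Cexp.
  replace (Re (Ci * beta * t)) with (- (Im beta) * t)
    by (destruct beta; simpl; ring).
  apply Rnot_lt_le; intros Hlt; apply exp_lt_inv in Hlt; revert Hlt.
  apply Rle_not_lt.
  apply Rle_trans with (Rabs (- Im beta * t)); [apply Rle_abs|].
  rewrite Rabs_mult, Rabs_Ropp.
  apply Rmult_le_compat_l; [apply Rabs_pos|].
  assert (H1 := Rle_abs theta); assert (H2 := Rle_abs (- theta)).
  rewrite Rabs_Ropp in H2; apply Rabs_le; lra.
- intros t _.
  replace (Ci * s * t)%C with (Ci * (s * t)%R)%C by (rewrite RtoC_mult; ring).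
  rewrite Cmod_mult, Cmod_Cexp_Ci; lra.
- intros n.
  refine (is_RInt_C_ext _ _ _ _ _ _ (is_RInt_Cmult (c ^ n) _ _ _ _ (HE n))).
  intros t _.
  replace (Ci * (beta + s * INR n) * t)%C
    with (Ci * beta * t + INR n * (Ci * s * t))%C by ring.
  rewrite Cexp_plus, Cexp_INR_mult, Cpow_mult_l; ring.
Qed.

(** The frequencies [s (n - n0)] are integers and vanish for [n = n0] only, so
    by orthogonality a single term of the geometric series contributes. *)
Lemma is_RInt_kernel_resonant (theta : R) (c : C) (s : Z) (n0 : nat) :
  Cmod c < 1 -> s <> 0%Z ->
  is_RInt (V := C_R_NormedModule)
    (fun t : R => Cexp (Ci * IZR (- s * Z.of_nat n0) * t)
                  / (1 - c * Cexp (Ci * IZR s * t)))%C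
    (theta - 2 * PI) theta (2 * PI * c ^ n0)%C.
Proof.
intros Hc Hs.
destruct (is_RInt_kernel theta (IZR (- s * Z.of_nat n0)) c (IZR s)
  (fun n => if Nat.eq_dec n n0 then (2 * PI)%C else 0) Hc)
  as [l [Hl HI]].
- intros n.
  rewrite INR_IZR_INZ, <- RtoC_mult, <- RtoC_plus, <- mult_IZR, <- plus_IZR.
  destruct (Nat.eq_dec n n0) as [-> | Hn].
  + apply is_RInt_Cexp_turn_0; do 2 f_equal; ring.
  + apply is_RInt_Cexp_turn_Z; nia.
- apply (is_series_single _ n0) in Hl.
  + destruct (Nat.eq_dec n0 n0) in Hl; [|tauto].
    rewrite Hl, (Cmult_comm (c ^ n0)) in HI; exact HI.
  + intros n Hn; destruct (Nat.eq_dec n n0); [tauto|ring].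
Qed.

(** * The hypergeometric series *)

Lemma Cpoch_1 (n : nat) : Cpoch 1 n = INR (fact n).
Proof.
induction n as [|n IH]; [reflexivity|].
change (Cpoch 1 (S n)) with (Cpoch 1 n * (1 + INR n))%C.
rewrite IH, fact_simpl, mult_INR, S_INR, RtoC_mult, RtoC_plus; ring.
Qed.

Lemma Cpoch_shift (b : C) (n : nat) :
  (b * Cpoch (1 + b) n = Cpoch b n * (b + INR n))%C.
Proof.
induction n as [|n IH]; [simpl; ring|].
simpl Cpoch; rewrite Cmult_assoc, IH, S_INR, RtoC_plus; ring.
Qed.

Lemma Cpoch_neq_0 (x : C) (n : nat) :
  (forall k : nat, (x + INR k)%C <> 0) -> Cpoch x n <> 0.
Proof.
intros Hx; induction n as [|n IH]; simpl.
- intros E; apply RtoC_inj in E; lra.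
- now apply Cmult_neq_0.
Qed.

(** The quotient [(b)_n / (1 + b)_n] telescopes to [b / (b + n)], and [(1)_n]
    cancels [n!]. *)
Lemma hyp2F1_term_1_succ (b z : C) (n : nat) :
  (forall k : nat, (b + INR k)%C <> 0) ->
  hyp2F1_term 1 b (1 + b) z n = (b / (b + INR n) * z ^ n)%C.
Proof.
intros Hb; unfold hyp2F1_term.
rewrite Cpoch_1.
assert (Hf : RtoC (INR (fact n)) <> 0).
{ intros E; apply RtoC_inj in E; exact (INR_fact_neq_0 n E). }
assert (Hp : Cpoch (1 + b) n <> 0).
{ apply Cpoch_neq_0; intros k.
  replace (1 + b + INR k)%C with (b + INR (S k))%C
    by (rewrite S_INR, RtoC_plus; ring).
  apply Hb. }
specialize (Hb n).
f_equal.
replace (b / (b + INR n))%C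
  with (b * Cpoch (1 + b) n / ((b + INR n) * Cpoch (1 + b) n))%C
  by (field; auto).
rewrite Cpoch_shift; field; auto.
Qed.

(** With [A] the value for [n = 0], the [n]-th term of the integrated series is
    [A] times the [n]-th hypergeometric term: [s n] being an integer,
    [e^(-2 pi i (beta + s n)) = e^(-2 pi i beta)], and [s s = 1] turns
    [beta + s n] into [s (s beta + n)]. *)
Lemma is_RInt_kernel_hyp2F1 (theta : R) (beta c : C) (s : Z) :
  Cmod c < 1 -> (s * s = 1)%Z ->
  (forall n : nat, (beta + IZR s * INR n)%C <> 0) ->
  is_RInt (V := C_R_NormedModule)
    (fun t : R => Cexp (Ci * beta * t) / (1 - c * Cexp (Ci * IZR s * t)))%C
    (theta - 2 * PI) theta
    (Cexp (Ci * beta * theta) * (1 - Cexp (- (2 * PI * Ci * beta)))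
     / (Ci * beta)
     * hyp2F1 1 (IZR s * beta) (1 + IZR s * beta)
         (c * Cexp (Ci * IZR s * theta)))%C.
Proof.
intros Hc Hs Hb.
assert (Hi : Ci <> 0) by (intros E; injection E; lra).
assert (HsC : (IZR s * IZR s)%C = 1)
  by (rewrite <- RtoC_mult, <- mult_IZR, Hs; reflexivity).
assert (Hs0 : RtoC (IZR s) <> 0)
  by (intros E; apply RtoC_inj, eq_IZR in E; lia).
assert (Hb0 : beta <> 0).
{ specialize (Hb 0%nat); intros E; apply Hb; rewrite E; simpl; ring. }
set (A := (Cexp (Ci * beta * theta) * (1 - Cexp (- (2 * PI * Ci * beta)))
           / (Ci * beta))%C).
set (z := (c * Cexp (Ci * IZR s * theta))%C).
assert (Hb' : forall n : nat, (IZR s * beta + INR n)%C <> 0).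
{ intros n E; apply (Hb n).
  replace (beta + IZR s * INR n)%C
    with (IZR s * IZR s * beta + IZR s * INR n)%C by (rewrite HsC; ring).
  replace (IZR s * IZR s * beta + IZR s * INR n)%C
    with (IZR s * (IZR s * beta + INR n))%C by ring.
  rewrite E; ring. }
destruct (is_RInt_kernel theta beta c (IZR s) _ Hc
  (fun n => is_RInt_Cexp_turn theta _ (Hb n))) as [l [Hl HI]].
replace (A * _)%C with l; [exact HI|].
assert (HT : is_series (V := C_NormedModule)
  (fun n => A * hyp2F1_term 1 (IZR s * beta) (1 + IZR s * beta) z n)%C l).
{ revert Hl; apply is_series_C_ext; intros n.
  rewrite hyp2F1_term_1_succ by exact Hb'.
  replace (- (2 * PI * Ci * (beta + IZR s * INR n)))%C
    with (- (2 * PI * Ci * beta) + 2 * PI * Ci * IZR (- (s * Z.of_nat n)))%C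
    by (rewrite opp_IZR, mult_IZR, <- INR_IZR_INZ, RtoC_opp, RtoC_mult; ring).
  replace (Ci * (beta + IZR s * INR n) * theta)%C
    with (Ci * beta * theta + INR n * (Ci * IZR s * theta))%C by ring.
  rewrite !Cexp_plus, Cexp_period, Cexp_INR_mult.
  unfold z, A; rewrite Cpow_mult_l.
  replace (IZR s * beta + INR n)%C
    with (IZR s * (beta + IZR s * INR n))%C.
  - field; auto.
  - replace (INR n : C) with (IZR s * IZR s * INR n)%C at 2
      by (rewrite HsC; ring).
    ring. }
(* [A] vanishes when [beta] is a nonzero integer with [s beta > 0].  The
   integrated series is then identically zero and tells nothing about the
   hypergeometric one, but both sides are zero.  Otherwise dividing by [A]
   shows that the hypergeometric series converges. *)
destruct (Ceq_dec A 0) as [HA | HA].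
- rewrite (is_series_single _ 0 l) with (2 := HT); rewrite HA; [ring|].
  intros n _; ring.
- rewrite (hyp2F1_unique _ _ _ _ (/ A * l)%C).
  + field; exact HA.
  + apply (is_series_scal (V := C_NormedModule) (/ A)%C) in HT.
    revert HT; apply is_series_C_ext; intros n.
    unfold scal; simpl; unfold mult; simpl; field; exact HA.
Qed.

(** * The contour integral *)

Lemma circle_denominator_neq_0 (alpha : C) (t : R) :
  Cmod alpha <> 1 -> (Cexp (Ci * t) - alpha)%C <> 0.
Proof.
intros Ha E; apply Ha; rewrite <- (Cmod_Cexp_Ci t).
replace alpha with (Cexp (Ci * t) - (Cexp (Ci * t) - alpha))%C by ring.
rewrite E; f_equal; ring.
Qed.

Lemma is_circle_int_m_inside (theta : R) (alpha beta l : C) :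
  Cmod alpha < 1 ->
  is_RInt (V := C_R_NormedModule)
    (fun t : R =>
       Cexp (Ci * beta * t) / (1 - alpha * Cexp (Ci * IZR (-1) * t)))%C
    (theta - 2 * PI) theta l ->
  is_circle_int theta (m alpha beta theta) (Ci * l)%C.
Proof.
intros Ha H; apply is_circle_int_m.
refine (is_RInt_C_ext _ _ _ _ _ _ (is_RInt_Cmult Ci _ _ _ _ H)).
intros t _.
assert (He := Cexp_neq_0 (Ci * t)).
assert (Hd := circle_denominator_neq_0 alpha t ltac:(lra)).
replace (Ci * IZR (-1) * t)%C with (- (Ci * t))%C by ring.
rewrite Cexp_opp.
field; repeat split; auto.
Qed.

(** Splitting [e^(it) / (e^(it) - alpha)] as [1 - 1 / (1 - e^(it) / alpha)]
    keeps the exponent [beta] in the kernel; expanding the product directly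
    would shift it to [beta + 1].  The term [l0] accounts for the summand [1]
    and for the [1] in the factor [1 - 2F1] of the closed form. *)
Lemma is_circle_int_m_outside (theta : R) (alpha beta l l0 : C) :
  1 < Cmod alpha ->
  is_RInt (V := C_R_NormedModule)
    (fun t : R =>
       Cexp (Ci * beta * t) / (1 - / alpha * Cexp (Ci * IZR 1 * t)))%C
    (theta - 2 * PI) theta l ->
  is_RInt (V := C_R_NormedModule) (fun t : R => Cexp (Ci * beta * t))
    (theta - 2 * PI) theta l0 ->
  is_circle_int theta (m alpha beta theta) (Ci * (l0 - l))%C.
Proof.
intros Ha H H0; apply is_circle_int_m.
refine (is_RInt_C_ext _ _ _ _ _ _
  (is_RInt_Cmult Ci _ _ _ _
     (is_RInt_minus (V := C_R_NormedModule) _ _ _ _ _ _ H0 H))).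
intros t _.
assert (Ha0 : alpha <> 0) by (apply Cmod_gt_0; lra).
assert (Hd := circle_denominator_neq_0 alpha t ltac:(lra)).
replace (Ci * IZR 1 * t)%C with (Ci * t)%C by ring.
change (Ci * (Cexp (Ci * beta * t)
              - Cexp (Ci * beta * t) / (1 - / alpha * Cexp (Ci * t)))
  = Cexp (Ci * beta * t) / (Cexp (Ci * t) - alpha) * (Ci * Cexp (Ci * t)))%C.
field; repeat split; auto.
intros E; apply Hd.
replace (Cexp (Ci * t) - alpha)%C with (- (alpha - Cexp (Ci * t)))%C by ring.
rewrite E; ring.
Qed.

Theorem theorem1 (theta : R) (alpha beta : C)
  (htheta : 0 < theta < 2 * PI) (halpha : Cmod alpha <> 1) :
  (1 < Cmod alpha ->
     (forall k : Z, (k < 0)%Z -> beta = RtoC (IZR k) ->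
        is_circle_int theta (m alpha beta theta)
          (- (2 * PI * Ci * Cpowz alpha k))%C)
  /\ (beta = RtoC 0 ->
        is_circle_int theta (m alpha beta theta) (RtoC 0))
  /\ (~ (exists k : Z, (k <= 0)%Z /\ beta = RtoC (IZR k)) ->
        is_circle_int theta (m alpha beta theta)
          (Cexp (Ci * beta * theta) * (1 - Cexp (- (2 * PI * Ci * beta)))
           * (1 / beta)
           * (1 - hyp2F1 1 beta (1 + beta) (/ alpha * Cexp (Ci * theta))))%C))
  /\
  (Cmod alpha < 1 ->
     (forall k : Z, (0 <= k)%Z -> beta = RtoC (IZR k) ->
        is_circle_int theta (m alpha beta theta)
          (2 * PI * Ci * Cpowz alpha k)%C)
  /\ (~ (exists k : Z, (0 <= k)%Z /\ beta = RtoC (IZR k)) ->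
        is_circle_int theta (m alpha beta theta)
          (Cexp (Ci * beta * theta) * (1 - Cexp (- (2 * PI * Ci * beta)))
           * (1 / beta)
           * hyp2F1 1 (- beta) (1 - beta) (alpha * Cexp (- (Ci * theta))))%C)).
Proof.
assert (Hi : Ci <> 0) by (intros E; injection E; lra).
split; intros Ha.
- assert (Ha0 : alpha <> 0) by (apply Cmod_gt_0; lra).
  assert (Hc : Cmod (/ alpha) < 1).
  { rewrite Cmod_inv by exact Ha0; rewrite <- Rinv_1.
    apply Rinv_lt_contravar; lra. }
  split; [|split].
  + intros k Hk ->.
    destruct k as [|p|p]; try lia.
    assert (H := is_RInt_kernel_resonant theta (/ alpha) 1 (Pos.to_nat p)
      Hc ltac:(lia)).
    replace (- (1) * Z.of_nat (Pos.to_nat p))%Z with (Z.neg p) in H by lia.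
    assert (H0 := is_RInt_Cexp_turn_Z theta (Z.neg p) ltac:(lia)).
    assert (HH := is_circle_int_m_outside _ _ _ _ _ Ha H H0).
    simpl Cpowz; rewrite Cpow_inv in HH by exact Ha0.
    replace (- (2 * PI * Ci * / alpha ^ Pos.to_nat p))%C
      with (Ci * (0 - 2 * PI * / alpha ^ Pos.to_nat p))%C by ring.
    exact HH.
  + intros ->.
    assert (H := is_RInt_kernel_resonant theta (/ alpha) 1 0 Hc ltac:(lia)).
    assert (HH := is_circle_int_m_outside _ _ _ _ _ Ha H
      (is_RInt_Cexp_turn_0 theta _ eq_refl)).
    replace (RtoC 0) with (Ci * (2 * PI - 2 * PI * (/ alpha) ^ 0))%C at 2
      by (simpl; ring).
    exact HH.
  + intros Hb.
    assert (Hb' : forall n : nat, (beta + IZR 1 * INR n)%C <> 0).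
    { intros n E; apply Hb; exists (- Z.of_nat n)%Z; split; [lia|].
      rewrite opp_IZR, <- INR_IZR_INZ, RtoC_opp.
      replace beta with (beta + IZR 1 * INR n - INR n)%C by ring.
      rewrite E; ring. }
    assert (Hb0 : beta <> 0).
    { intros E; apply (Hb' 0%nat); rewrite E; simpl; ring. }
    assert (HH := is_circle_int_m_outside _ _ _ _ _ Ha
      (is_RInt_kernel_hyp2F1 theta beta _ 1 Hc eq_refl Hb')
      (is_RInt_Cexp_turn theta _ Hb0)).
    replace (IZR 1 * beta)%C with beta in HH by ring.
    replace (Ci * IZR 1 * theta)%C with (Ci * theta)%C in HH by ring.
    match type of HH with is_circle_int _ _ ?l =>
      match goal with |- is_circle_int _ _ ?l' =>
        replace l' with l; [exact HH|field; auto] end end.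
- split.
  + intros k Hk ->.
    assert (H := is_RInt_kernel_resonant theta alpha (-1) (Z.to_nat k)
      Ha ltac:(lia)).
    replace (- (-1) * Z.of_nat (Z.to_nat k))%Z with k in H by lia.
    assert (HH := is_circle_int_m_inside _ _ _ _ Ha H).
    replace (2 * PI * Ci * Cpowz alpha k)%C
      with (Ci * (2 * PI * alpha ^ Z.to_nat k))%C; [exact HH|].
    destruct k as [|p|p]; [simpl; ring|simpl; ring|lia].
  + intros Hb.
    assert (Hb' : forall n : nat, (beta + IZR (-1) * INR n)%C <> 0).
    { intros n E; apply Hb; exists (Z.of_nat n); split; [lia|].
      rewrite <- INR_IZR_INZ.
      replace beta with (beta + IZR (-1) * INR n + INR n)%C by ring.
      rewrite E; ring. }
    assert (Hb0 : beta <> 0).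
    { intros E; apply (Hb' 0%nat); rewrite E; simpl; ring. }
    assert (HH := is_circle_int_m_inside _ _ _ _ Ha
      (is_RInt_kernel_hyp2F1 theta beta _ (-1) Ha eq_refl Hb')).
    replace (IZR (-1) * beta)%C with (- beta)%C in HH by ring.
    replace (1 + - beta)%C with (1 - beta)%C in HH by ring.
    replace (Ci * IZR (-1) * theta)%C with (- (Ci * theta))%C in HH by ring.
    match type of HH with is_circle_int _ _ ?l =>
      match goal with |- is_circle_int _ _ ?l' =>
        replace l' with l; [exact HH|field; auto] end end.
Qed.
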